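(* Let $X$ be a $C^{2}$ vector field on an open subset of $\mathbb{R}^2$ with $X(p)=0$ and $DX(p)$ nilpotent of rank one, let $q_0$ span $\ker DX(p)$, and let $a,b$ be the Bogdanov--Takens coefficients of $X$ at $p$ associated with $q_0$. Let $h$ be a positive $C^{2}$ function and $\widetilde X=hX$. Then $\widetilde X$ has the same equilibrium $p$ with the same kernel direction, and its coefficients $\widetilde a,\widetilde b$ at $p$ associated with the same $q_0$ are $$\widetilde a=h(p)^{2}\,a,\qquad \widetilde b=h(p)\,b .$$ In particular $\{a=0\}$, $\{b=0\}$ and $\operatorname{sign}(ab)$ are invariants of the orbit foliation.
   Context: Bogdanov--Takens coefficients of $X$ at $p$ associated with $q_0$: put $J=DX(p)$, $B(u,v)=D^2X(p)[u,v]$, choose $(q_1,p_0,p_1)$ with $Jq_1=q_0$, $J^{\top}p_1=0$, $J^{\top}p_0=p_1$, $\langle q_0,p_0\rangle=\langle q_1,p_1\rangle=1$, $\langle q_0,p_1\rangle=\langle q_1,p_0\rangle=0$, and set $a=\tfrac12\langle p_1,B(q_0,q_0)\rangle$, $b=\langle p_0,B(q_0,q_0)\rangle+\langle p_1,B(q_0,q_1)\rangle$. These depend only on $X$ and $q_0$. *)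

(* Defs.v *)
From HB Require Import structures.
From mathcomp Require Import all_boot all_order all_algebra.
From mathcomp Require Import all_classical all_reals all_analysis.

Set Implicit Arguments.
Unset Strict Implicit.
Unset Printing Implicit Defensive.

Import Order.TTheory GRing.Theory Num.Theory.
Import numFieldNormedType.Exports.

Local Open Scope classical_set_scope.
Local Open Scope ring_scope.

(* Vectors are row vectors, and ['J f x] acts on the right:
   [Df(x) v = v *m 'J f x].  Hence, with [J := 'J X p], the vectors [J q] and
   [J^T q] of the column convention are [q *m J] and [q *m J^T] here, and the
   kernel of [DX(p)] is the row space of [kermx J]. *)

Definition dot (R : realType) (n : nat) (u v : 'rV[R]_n) : R :=
  (u *m v^T) 0 0.

(* [C1_on] and [C2_on] are meant for an open [U]; the domain being
   finite-dimensional, continuity of [x |-> Df(x)] in operator norm is the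
   same as continuity of [x |-> Df(x) v] for every [v]. *)
Definition C1_on (R : realType) (n : nat) (W : normedModType R)
    (U : set 'rV[R]_n) (f : 'rV[R]_n -> W) : Prop :=
  (forall x, U x -> differentiable f x) /\
  (forall v x, U x -> {for x, continuous ('D_v f)}).

Definition C2_on (R : realType) (n : nat) (W : normedModType R)
    (U : set 'rV[R]_n) (f : 'rV[R]_n -> W) : Prop :=
  C1_on U f /\ (forall v, C1_on U ('D_v f)).

(* D^2 X(p)[u, v] *)
Definition D2 (R : realType) (n : nat) (W : normedModType R)
    (X : 'rV[R]_n -> W) (p u v : 'rV[R]_n) : W :=
  'D_u ('D_v X) p.

Definition nilpotent_mx (R : realType) (n : nat) (A : 'M[R]_n.+1) : Prop :=
  exists k : nat, A ^+ k = 0.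

Definition spans_kernel (R : realType) (X : 'rV[R]_2 -> 'rV[R]_2)
    (p q0 : 'rV[R]_2) : Prop :=
  (q0 == kermx ('J X p))%MS.

Definition BT_equilibrium (R : realType) (U : set 'rV[R]_2)
    (X : 'rV[R]_2 -> 'rV[R]_2) (p : 'rV[R]_2) : Prop :=
  [/\ open U, U p, C2_on U X &
      [/\ X p = 0, nilpotent_mx ('J X p) & \rank ('J X p) = 1%N]].

Definition BT_frame (R : realType) (J : 'M[R]_2)
    (q0 q1 p0 p1 : 'rV[R]_2) : Prop :=
  [/\ q1 *m J = q0, p1 *m J^T = 0, p0 *m J^T = p1 &
      [/\ dot q0 p0 = 1, dot q1 p1 = 1, dot q0 p1 = 0 & dot q1 p0 = 0]].

(* [a] and [b] do not depend on the frame, so they are given as the values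
   read off from some frame. *)
Definition BT_coeffs (R : realType) (X : 'rV[R]_2 -> 'rV[R]_2)
    (p q0 : 'rV[R]_2) (a b : R) : Prop :=
  exists q1 p0 p1 : 'rV[R]_2,
    [/\ BT_frame ('J X p) q0 q1 p0 p1,
        a = 2^-1 * dot p1 (D2 X p q0 q0) &
        b = dot p0 (D2 X p q0 q0) + dot p1 (D2 X p q0 q1)].

(* A field keeps the same oriented orbits when it is multiplied by a positive
   function; [h] is as regular as the fields. *)
Definition same_orbit_foliation (R : realType) (U : set 'rV[R]_2)
    (X Y : 'rV[R]_2 -> 'rV[R]_2) : Prop :=
  exists h : 'rV[R]_2 -> R,
    [/\ C2_on U (h : 'rV[R]_2 -> R^o), forall x, U x -> 0 < h x &
        forall x, U x -> Y x = h x *: X x].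

(* Main.v *)
(* At a zero [p] of [X] the product rule gives [D(hX)(p) = h(p) DX(p)] and
   [D^2(hX)(p)[u, v] = h(p) D^2X(p)[u, v] + Dh(p)[u] DX(p)v + Dh(p)[v] DX(p)u].
   For [u = v = q0] the two correction terms vanish, and for [u = q0], [v = q1]
   they reduce to [Dh(p)[q0] q0], which is killed by [p1].  A frame of [hX] for
   the kernel vector [s q0] is [(s / h q1, p0 / s, h / s p1)], with [h = h(p)],
   so the coefficients are multiplied by [s h^2] and [s h], and their product
   by [s^2 h^3 > 0]. *)

Require Import Defs.
From HB Require Import structures.
From mathcomp Require Import all_boot all_order all_algebra.
From mathcomp Require Import all_classical all_reals all_analysis.
From mathcomp Require Import ring.

Set Implicit Arguments.
Unset Strict Implicit.
Unset Printing Implicit Defensive.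

Import Order.TTheory GRing.Theory Num.Theory.
Import numFieldNormedType.Exports.
Local Open Scope classical_set_scope.
Local Open Scope ring_scope.

(** * Locality of continuity and differentiability *)

Lemma near_eq_continuous (T S : topologicalType) (f g : T -> S) (x : T) :
  {near x, f =1 g} -> {for x, continuous g} -> {for x, continuous f}.
Proof.
move=> fg cg; rewrite /prop_for /continuous_at (nbhs_singleton fg).
apply: cvg_trans cg; apply: near_eq_cvg.
by apply: filterS fg => y ->.
Qed.

(** Near [x] the first-order remainders of [f] and [g] coincide, so ['d g x] also approximates [f];
    uniqueness of the differential then identifies it with ['d f x]. *)
Lemma near_eq_differentiable (R : numFieldType) (V W : normedModType R)
    (f g : V -> W) (x : V) :
  {near x, f =1 g} -> differentiable g x ->
  differentiable f x.
Proof.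
move=> fg dg; have fx : f x = g x := nbhs_singleton fg.
have dc : continuous ('d g x) by exact: diff_continuous.
have ef : f \o shift x = cst (f x) + 'd g x +o_ 0 id.
  apply/eqaddoE/eqaddoP => e e0.
  have /eqaddoP /(_ e e0) ge := diff_locally dg.
  have fg0 : \forall y \near (0 : V), f (y + x) = g (y + x).
    by move: fg; rewrite (near_shift 0) subr0; apply: filterS => y /=.
  near=> y.
  have -> : (f \o shift x - (cst (f x) + 'd g x)) y =
            (g \o shift x - (cst (g x) + 'd g x)) y.
    by rewrite !fctE /= fx; congr (_ - _); near: y.
  by near: y.
have de : 'd f x = 'd g x :> (V -> W) := diff_unique dc ef.
by apply/diff_locallyP; split; rewrite de.
Unshelve. all: by end_near. Qed.

(** * Product rule for a scalar function times a vector-valued one *)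

Section bilinear_scale.
Variables (R : numFieldType) (W : normedModType R).

(** The scalar lives in [R^o], a normed module, so that scaling falls under the differentiation rule
    for continuous bilinear maps. *)
Definition scalep (k : R^o) (w : W) : W := k *: w.

Lemma scalep_is_bilinear :
  bilinear_for
    (GRing.Scale.Law.clone _ _ *:%R _) (GRing.Scale.Law.clone _ _ *:%R _)
    scalep.
Proof.
split=> [w|k] a x y /=; rewrite /scalep.
- by rewrite scalerDl scalerA.
- by rewrite scalerDr !scalerA mulrC.
Qed.

HB.instance Definition _ := bilinear_isBilinear.Build R R^o W W _ _ scalep
  scalep_is_bilinear.

End bilinear_scale.

(** The product is the pairing of [k] and [f] followed by [scalep], and the chain rule applies. *)
Lemma is_diff_scale (R : numFieldType) (V W : normedModType R)
    (k : V -> R^o) (f : V -> W) (x : V) :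
  differentiable k x -> differentiable f x ->
  is_diff x (fun y => k y *: f y)
    (fun v => k x *: 'd f x v + 'd k x v *: f x).
Proof.
move=> dk df.
pose S q := @scalep R W q.1 q.2.
have cS : continuous S by move=> q; exact: scale_continuous.
have dS : differentiable S (k x, f x) by exact: differentiable_bilin.
have -> : (fun y => k y *: f y) = S \o (fun y => (k y, f y)) by [].
have dp : differentiable (fun y => (k y, f y)) x by exact: differentiable_pair.
apply: DiffDef; first exact: differentiable_comp.
by rewrite diff_comp // diff_pair // diff_bilin.
Qed.

(** * The classes C^1 and C^2 on an open set *)

Section Ck_on.
Variables (R : realType) (n : nat) (W : normedModType R) (U : set 'rV[R]_n).
Hypothesis oU : open U.

(** Openness turns equality on [U] into equality near each point of [U]; this is how a field
    prescribed only on [U] gets differentiated. *)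
Lemma near_eq_on (f g : 'rV[R]_n -> W) (x : 'rV[R]_n) :
  (forall y, U y -> f y = g y) -> U x -> {near x, f =1 g}.
Proof. by move=> fg Ux; exact: filterS fg (open_nbhs_nbhs (conj oU Ux)). Qed.

Lemma eq_on_derive (f g : 'rV[R]_n -> W) (v x : 'rV[R]_n) :
  (forall y, U y -> f y = g y) -> U x -> 'D_v f x = 'D_v g x.
Proof. by move=> fg Ux; apply: near_eq_derive; exact: near_eq_on. Qed.

Lemma eq_on_C1 (f g : 'rV[R]_n -> W) :
  (forall y, U y -> f y = g y) -> C1_on U g -> C1_on U f.
Proof.
move=> fg [dg cg]; split=> [x Ux|v x Ux].
  exact: near_eq_differentiable (near_eq_on fg Ux) (dg _ Ux).
apply: near_eq_continuous (cg v x Ux).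
by apply: near_eq_on => // y; exact: eq_on_derive.
Qed.

Lemma eq_on_C2 (f g : 'rV[R]_n -> W) :
  (forall y, U y -> f y = g y) -> C2_on U g -> C2_on U f.
Proof.
move=> fg [g1 g2]; split; first exact: eq_on_C1 g1.
by move=> v; apply: eq_on_C1 (g2 v) => y; exact: eq_on_derive.
Qed.

Lemma C1_continuous (f : 'rV[R]_n -> W) (x : 'rV[R]_n) :
  C1_on U f -> U x -> {for x, continuous f}.
Proof. by move=> [df _] /df; exact: differentiable_continuous. Qed.

Lemma C1_add (f g : 'rV[R]_n -> W) :
  C1_on U f -> C1_on U g -> C1_on U (f + g).
Proof.
move=> [df cf] [dg cg]; split=> [x Ux|v].
  by apply: differentiableD; [exact: df | exact: dg].
have e y : U y -> 'D_v (f + g) y = ('D_v f + 'D_v g) y.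
  by move=> Uy; rewrite deriveD //;
     apply: diff_derivable; [exact: df|exact: dg].
move=> x Ux; apply: near_eq_continuous (near_eq_on e Ux) _.
exact: (continuousD (cf v x Ux) (cg v x Ux)).
Qed.

Lemma derive_scale (k : 'rV[R]_n -> R^o) (f : 'rV[R]_n -> W) (v x : 'rV[R]_n) :
  differentiable k x -> differentiable f x ->
  'D_v (fun y => k y *: f y) x = k x *: 'D_v f x + 'D_v k x *: f x.
Proof.
move=> dk df; have kf := is_diff_scale dk df; have [dkf _] := kf.
by rewrite (deriveE _ dk) (deriveE _ df) (deriveE _ dkf) diff_val.
Qed.

Lemma C1_scale (k : 'rV[R]_n -> R^o) (f : 'rV[R]_n -> W) :
  C1_on U k -> C1_on U f -> C1_on U (fun y => k y *: f y).
Proof.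
move=> Ck Cf; have [dk ck] := Ck; have [df cf] := Cf; split=> [x Ux|v x Ux].
  by have [] := is_diff_scale (dk _ Ux) (df _ Ux).
have e y : U y -> 'D_v (fun y => k y *: f y) y =
    ((fun y => k y *: 'D_v f y) + (fun y => 'D_v k y *: f y)) y.
  by move=> Uy; rewrite derive_scale; [|exact: dk|exact: df].
apply: near_eq_continuous (near_eq_on e Ux) _.
apply: continuousD.
  apply: (continuousZ (differentiable_continuous (dk _ Ux)) (cf v x Ux)).
exact: (continuousZ (ck v x Ux) (C1_continuous Cf Ux)).
Qed.

(** On [U] the derivative of the product is a sum of two products of C^1 functions, so the C^1 case
    applies to each. *)
Lemma C2_scale (k : 'rV[R]_n -> R^o) (f : 'rV[R]_n -> W) :
  C2_on U k -> C2_on U f -> C2_on U (fun y => k y *: f y).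
Proof.
move=> [Ck Ck2] [Cf Cf2]; split; first exact: C1_scale.
move=> v; apply: (@eq_on_C1 _
    ((fun y => k y *: 'D_v f y) + (fun y => 'D_v k y *: f y))).
  by move=> y Uy; apply: derive_scale; [exact: Ck.1|exact: Cf.1].
exact: C1_add (C1_scale Ck (Cf2 v)) (C1_scale (Ck2 v) Cf).
Qed.

End Ck_on.

(** * Linearity of the second derivative and the product rule at a zero *)

Section second_derivative.
Variables (R : realType) (n : nat) (W : normedModType R) (U : set 'rV[R]_n).
Hypothesis oU : open U.

(** The vector [v] directs the inner derivative, so its scalar is first pulled out on all of [U],
    and the result is then differentiated at [p]. *)
Lemma D2_scaler (X : 'rV[R]_n -> W) (p u v : 'rV[R]_n) (s : R) :
  C2_on U X -> U p -> D2 X p u (s *: v) = s *: D2 X p u v.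
Proof.
move=> [[dX _] X2] Up; rewrite /D2.
rewrite (@eq_on_derive _ _ _ _ oU _ (s *: 'D_v X)) //; last first.
  by move=> y Uy; rewrite fctE !deriveE ?linearZ //; exact: dX.
by rewrite deriveZ //; apply: diff_derivable; exact: (X2 v).1.
Qed.

Lemma D2_addr (X : 'rV[R]_n -> W) (p u v w : 'rV[R]_n) :
  C2_on U X -> U p -> D2 X p u (v + w) = D2 X p u v + D2 X p u w.
Proof.
move=> [[dX _] X2] Up; rewrite /D2.
rewrite (@eq_on_derive _ _ _ _ oU _ ('D_v X + 'D_w X)) //; last first.
  by move=> y Uy; rewrite fctE !deriveE ?linearD //; exact: dX.
by rewrite deriveD //; apply: diff_derivable; [exact: (X2 v).1|exact: (X2 w).1].
Qed.

Lemma D2_scalel (X : 'rV[R]_n -> W) (p u v : 'rV[R]_n) (s : R) :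
  C2_on U X -> U p -> D2 X p (s *: u) v = s *: D2 X p u v.
Proof.
by move=> [_ X2] Up; rewrite /D2 !deriveE ?linearZ //; exact: (X2 v).1.
Qed.

(** Differentiating the product rule again gives four terms; the one with the second derivative of
    [k] carries the factor [X p = 0]. *)
Lemma D2_scale (k : 'rV[R]_n -> R^o) (X : 'rV[R]_n -> W) (p u v : 'rV[R]_n) :
  C2_on U k -> C2_on U X -> U p -> X p = 0 ->
  D2 (fun x => k x *: X x) p u v =
    k p *: D2 X p u v + 'D_u k p *: 'D_v X p + 'D_v k p *: 'D_u X p.
Proof.
move=> [[dk _] k2] [[dX _] X2] Up Xp; rewrite /D2.
rewrite (@eq_on_derive _ _ _ _ oU _
  ((fun y => k y *: 'D_v X y) + (fun y => 'D_v k y *: X y))) //; last first.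
  by move=> y Uy; rewrite derive_scale //; [exact: dk|exact: dX].
have [dkp dXp dkvp dXvp] : [/\ differentiable k p, differentiable X p,
    differentiable ('D_v k) p & differentiable ('D_v X) p].
  by split; [exact: dk|exact: dX|exact: (k2 v).1|exact: (X2 v).1].
have [d1 _] := is_diff_scale dkp dXvp.
have [d2 _] := is_diff_scale dkvp dXp.
rewrite deriveD; [|exact: diff_derivable|exact: diff_derivable].
by rewrite !derive_scale // Xp scaler0 addr0.
Qed.

Lemma eq_on_D2 (X Y : 'rV[R]_n -> W) (p u v : 'rV[R]_n) :
  (forall x, U x -> X x = Y x) -> U p -> D2 X p u v = D2 Y p u v.
Proof.
by move=> XY Up; apply: (eq_on_derive oU) => // y Uy; exact: (eq_on_derive oU).
Qed.

End second_derivative.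

(** Row [i] of a Jacobian is the derivative along [delta_mx 0 i]; in the product rule the derivative
    of [k] multiplies [X p = 0]. *)
Lemma jacobian_eq_scale (R : realType) (m n : nat) (U : set 'rV[R]_m)
    (k : 'rV[R]_m -> R^o) (X Y : 'rV[R]_m -> 'rV[R]_n) (p : 'rV[R]_m) :
  open U -> U p -> (forall x, U x -> Y x = k x *: X x) ->
  differentiable k p -> differentiable X p -> X p = 0 ->
  'J Y p = k p *: 'J X p.
Proof.
move=> oU Up YX dk dX Xp; apply/row_matrixP => i.
have [dkX _] := is_diff_scale dk dX.
have dY := near_eq_differentiable (near_eq_on oU YX Up) dkX.
rewrite (rowE i ('J Y p)) (rowE i (k p *: 'J X p)) -scalemxAr.
have := eq_on_derive oU (delta_mx 0 i) YX Up.
rewrite derive_scale // Xp scaler0 addr0.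
by rewrite (deriveEjacobian _ dY) (deriveEjacobian _ dX).
Qed.

(** * Dual frames and independence of the coefficients from the frame *)

Lemma dotDl (R : realType) n (u v w : 'rV[R]_n) :
  dot (u + v) w = dot u w + dot v w.
Proof. by rewrite /dot mulmxDl mxE. Qed.

Lemma dotDr (R : realType) n (u v w : 'rV[R]_n) :
  dot w (u + v) = dot w u + dot w v.
Proof. by rewrite /dot linearD mulmxDr mxE. Qed.

Lemma dotZl (R : realType) n (s : R) (u v : 'rV[R]_n) :
  dot (s *: u) v = s * dot u v.
Proof. by rewrite /dot -scalemxAl mxE. Qed.

Lemma dotZr (R : realType) n (s : R) (u v : 'rV[R]_n) :
  dot u (s *: v) = s * dot u v.
Proof. by rewrite /dot linearZ -scalemxAr mxE. Qed.

Lemma dotC (R : realType) n (u v : 'rV[R]_n) : dot u v = dot v u.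
Proof. by rewrite /dot -[in LHS](trmxK u) -trmx_mul mxE. Qed.

Lemma dot_dual_eq (R : realType) (q0 q1 p0 p1 u v : 'rV[R]_2) :
  [/\ dot q0 p0 = 1, dot q1 p1 = 1, dot q0 p1 = 0 & dot q1 p0 = 0] ->
  dot q0 u = dot q0 v -> dot q1 u = dot q1 v -> u = v.
Proof.
move=> [e00 e11 e01 e10] e0 e1.
pose Q : 'M[R]_(1 + 1) := col_mx q0 q1; pose P : 'M[R]_(1 + 1) := col_mx p0 p1.
have dotE (x y : 'rV[R]_2) : x *m y^T = (dot x y)%:M.
  by rewrite [LHS]mx11_scalar.
have QP : Q *m P^T = 1%:M.
  rewrite tr_col_mx mul_col_row !dotE e00 e11 e01 e10 !raddf0.
  by rewrite -scalar_mx_block.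
(* For square matrices the right inverse [P^T] of [Q] is also a left inverse, so [u^T] is [P^T]
   applied to [Q *m u^T], the column of pairings of [q0] and [q1] with [u]. *)
apply: trmx_inj; rewrite -[LHS]mul1mx -[RHS]mul1mx -(mulmx1C QP) -!mulmxA.
by rewrite !mul_col_mx !dotE e0 e1.
Qed.

(** The equation for [q1] fixes its factor [s / c]; the normalisations then give [p0] and [p1] the
    inverse factors of [q0] and [q1]. *)
Lemma BT_frame_scale (R : realType) (J : 'M[R]_2) (q0 q1 p0 p1 : 'rV[R]_2)
    (c s : R) :
  c != 0 -> s != 0 -> BT_frame J q0 q1 p0 p1 ->
  BT_frame (c *: J) (s *: q0) ((s / c) *: q1) (s^-1 *: p0) ((c / s) *: p1).
Proof.
move=> c0 s0 [qJ pJ pJ1 [e00 e11 e01 e10]]; split; last first.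
  by rewrite !dotZl !dotZr e00 e11 e01 e10; split; field; rewrite ?c0 ?s0.
- by rewrite linearZ /= -scalemxAr -scalemxAl scalerA pJ1 mulrC.
- by rewrite linearZ /= -scalemxAr -scalemxAl pJ !scaler0.
- by rewrite -scalemxAr -scalemxAl scalerA qJ; congr (_ *: _); field.
Qed.

Lemma kermx_scale (R : fieldType) (m n : nat) (A : 'M[R]_(m, n)) (c : R) :
  c != 0 -> (kermx (c *: A) :=: kermx A)%MS.
Proof.
move=> c0; apply/eqmxP/andP; split; rewrite sub_kermx.
  have := mulmx_ker (c *: A); rewrite -scalemxAr => /eqP.
  by rewrite scaler_eq0 (negPf c0).
by rewrite -scalemxAr mulmx_ker scaler0.
Qed.

(* Another frame has [q1' = q1 + s q0], [p1' = p1] and [p0' = p0 - s p1]; the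
   two contributions of [s] to [b] cancel. *)
Lemma BT_coeffs_uniq (R : realType) (U : set 'rV[R]_2)
    (X : 'rV[R]_2 -> 'rV[R]_2) (p q0 : 'rV[R]_2) (a b a' b' : R) :
  open U -> U p -> C2_on U X -> spans_kernel X p q0 ->
  BT_coeffs X p q0 a b -> BT_coeffs X p q0 a' b' -> a = a' /\ b = b'.
Proof.
move=> oU Up CX kq [q1 [p0 [p1 [F -> ->]]]] [q1' [p0' [p1' [F' -> ->]]]].
have [qJ _ _ dual] := F; have [qJ' _ _ dual'] := F'.
have [e00 e11 e01 e10] := dual; have [e00' e11' e01' e10'] := dual'.
(* Both [q1] and [q1'] are mapped to [q0], so their difference lies in the kernel line. *)
have [s /eqP] : exists s, q1' - q1 = s *: q0.
  apply/sub_rVP; move/andP: kq => [_ kq]; apply: submx_trans kq.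
  by rewrite sub_kermx mulmxBl qJ qJ' subrr.
rewrite subr_eq => /eqP q1E; rewrite {}q1E in qJ' dual' e11' e10' *.
have p1E : p1' = p1.
  apply: dot_dual_eq dual _ _; first by rewrite e01 e01'.
  by move: e11'; rewrite dotDl dotZl e01' mulr0 add0r e11.
(* The coefficient comes from [0 = dot q1' p0' = s + dot q1 p0']. *)
have p0E : p0' = p0 + (- s) *: p1.
  apply: dot_dual_eq dual _ _; rewrite dotDr dotZr.
    by rewrite e00 e00' e01 mulr0 addr0.
  move: e10'; rewrite dotDl dotZl e00' mulr1 e11 e10 => /eqP.
  by rewrite addrC addr_eq0 => /eqP ->; rewrite mulr1 add0r.
split; first by rewrite p1E.
rewrite p1E p0E (D2_addr oU _ _ _ CX Up) (D2_scaler oU _ _ _ CX Up).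
move: (D2 X p q0 q0) (D2 X p q0 q1) => B0 B1.
by rewrite dotDl dotDr dotZl dotZr; ring.
Qed.

(** * Effect of a positive time change at the equilibrium *)

Section time_change.
Variables (R : realType) (U : set 'rV[R]_2) (X Y : 'rV[R]_2 -> 'rV[R]_2).
Variables (p : 'rV[R]_2) (h : 'rV[R]_2 -> R).
Hypothesis eX : BT_equilibrium U X p.
Hypothesis h2 : C2_on U (h : 'rV[R]_2 -> R^o).
Hypothesis hpos : forall x, U x -> 0 < h x.
Hypothesis YE : forall x, U x -> Y x = h x *: X x.

Let oU : open U. Proof. by case: eX. Qed.
Let Up : U p. Proof. by case: eX. Qed.
Let X2 : C2_on U X. Proof. by case: eX. Qed.
Let Xp : X p = 0. Proof. by case: eX => _ _ _ []. Qed.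
Let hp0 : h p != 0. Proof. by rewrite gt_eqF ?hpos. Qed.

Lemma time_change_jacobian : 'J Y p = h p *: 'J X p.
Proof.
exact: (jacobian_eq_scale oU Up YE (h2.1.1 _ Up) (X2.1.1 _ Up) Xp).
Qed.

Lemma time_change_D2 (u v : 'rV[R]_2) :
  D2 Y p u v = h p *: D2 X p u v + 'D_u (h : _ -> R^o) p *: (v *m 'J X p)
               + 'D_v (h : _ -> R^o) p *: (u *m 'J X p).
Proof.
have dX := X2.1.1 _ Up.
rewrite (eq_on_D2 oU u v YE Up) (D2_scale oU u v h2 X2 Up Xp).
by rewrite !(deriveEjacobian _ dX).
Qed.

Lemma time_change_BT_equilibrium : BT_equilibrium U Y p.
Proof.
have [_ _ _ [_ [k Jk] rJ]] := eX; split; [exact: oU|exact: Up| |].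
  exact: (eq_on_C2 oU YE (C2_scale oU h2 X2)).
rewrite time_change_jacobian (YE Up) Xp scaler0; split; first by [].
  by exists k; rewrite exprZn Jk scaler0.
by rewrite mxrank_scale_nz.
Qed.

Lemma time_change_spans_kernel (q : 'rV[R]_2) :
  spans_kernel Y p q <-> spans_kernel X p q.
Proof.
by rewrite /spans_kernel time_change_jacobian !(kermx_scale ('J X p) hp0).
Qed.

(** The case [s = 1] gives the transformation formulas; general [s] serves the invariance claim,
    where the other field comes with its own kernel vector. *)
Lemma time_change_BT_coeffs (q0 : 'rV[R]_2) (a b s : R) : s != 0 ->
  spans_kernel X p q0 -> BT_coeffs X p q0 a b ->
  BT_coeffs Y p (s *: q0) (s * h p ^+ 2 * a) (s * h p * b).
Proof.
move=> s0 kq [q1 [p0 [p1 [F -> ->]]]].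
exists ((s / h p) *: q1), (s^-1 *: p0), ((h p / s) *: p1).
have q0J : q0 *m 'J X p = 0 by case/andP: kq; rewrite sub_kermx => /eqP.
have [q1J _ _ [_ _ e01 _]] := F; rewrite dotC in e01.
have Y2 : C2_on U Y by case: time_change_BT_equilibrium.
split; first by rewrite time_change_jacobian; exact: BT_frame_scale.
(* Pulling the frame factors out first leaves [D2 Y] at [(q0, q0)] and [(q0, q1)], where [q0J] and
   [q1J] simplify the correction terms. *)
all: rewrite !(D2_scaler oU _ _ _ Y2 Up) !(D2_scalel _ _ _ Y2 Up).
all: rewrite !time_change_D2 q0J ?q1J.
- move: (D2 X p q0 q0) ('D_q0 _ p) => B0 h0.
  by rewrite !scaler0 !addr0 !(dotZl, dotZr); field; rewrite ?s0 ?hp0.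
- move: (D2 X p q0 q0) (D2 X p q0 q1) ('D_q0 _ p) ('D_q1 _ p) => B0 B1 h0 h1.
  rewrite !scaler0 !addr0 !(dotDr, dotZl, dotZr) e01.
  by field; rewrite ?s0 ?hp0.
Qed.

End time_change.

Unset Implicit Arguments.

Theorem corollary2p9 (R : realType) (U : set 'rV[R]_2)
    (X : 'rV[R]_2 -> 'rV[R]_2) (p q0 : 'rV[R]_2) (a b : R)
    (h : 'rV[R]_2 -> R) (Xt : 'rV[R]_2 -> 'rV[R]_2)
    (hX : BT_equilibrium U X p) (hq0 : spans_kernel X p q0)
    (hab : BT_coeffs X p q0 a b)
    (hC2 : C2_on U (h : 'rV[R]_2 -> R^o)) (hpos : forall x, U x -> 0 < h x)
    (hXt : forall x, U x -> Xt x = h x *: X x) :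
  [/\ BT_equilibrium U Xt p,
      spans_kernel Xt p q0,
      forall at_ bt : R,
        BT_coeffs Xt p q0 at_ bt <-> at_ = h p ^+ 2 * a /\ bt = h p * b &
      forall (Y : 'rV[R]_2 -> 'rV[R]_2) (q0' : 'rV[R]_2) (a' b' : R),
        same_orbit_foliation U X Y ->
        spans_kernel Y p q0' -> BT_coeffs Y p q0' a' b' ->
        [/\ a' = 0 <-> a = 0, b' = 0 <-> b = 0 &
            Num.sg (a' * b') = Num.sg (a * b)]].
Proof.
have [oU Up _ _] := hX.
have eXt := time_change_BT_equilibrium hX hC2 hpos hXt.
have kXt := (time_change_spans_kernel hX hC2 hpos hXt q0).2 hq0.
have [_ _ Xt2 _] := eXt.
have hat := time_change_BT_coeffs hX hC2 hpos hXt (oner_neq0 R) hq0 hab.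
rewrite !mul1r scale1r in hat.
split=> [||at_ bt|Y q0' a' b' [k [k2 kpos kY]] hY hab'].
- exact: eXt.
- exact: kXt.
(* Since [BT_coeffs] is a relation, the forward direction is uniqueness of the coefficients. *)
- split=> [h'|[-> ->]]; last exact: hat.
  exact: BT_coeffs_uniq oU Up Xt2 kXt h' hat.
have eY := time_change_BT_equilibrium hX k2 kpos kY.
have [_ _ Y2 _] := eY.
have kX := (time_change_spans_kernel hX k2 kpos kY q0').1 hY.
(* [X] and [Y] have the same kernel line at [p], and [q0] spans it. *)
have [s q0'E] : exists s, q0' = s *: q0.
  case/andP: kX => kX _; case/andP: hq0 => _ kq.
  exact/sub_rVP/(submx_trans kX kq).
(* The vector [q0'] pairs to 1 with a member of its frame, hence is nonzero. *)
have s0 : s != 0.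
  apply/eqP => s0; have [q1 [p0 [p1 [[_ _ _ [e _ _ _]] _ _]]]] := hab'.
  move/eqP: e; rewrite q0'E s0 dotZl mul0r eq_sym.
  by rewrite oner_eq0.
have k0 := kpos p Up.
rewrite {}q0'E in hY hab' kX.
have ab := time_change_BT_coeffs hX k2 kpos kY s0 hq0 hab.
have [-> ->] := BT_coeffs_uniq oU Up Y2 hY hab' ab.
have kn0 : k p != 0 by rewrite gt_eqF.
split.
- split=> [/eqP|->]; last by rewrite mulr0.
  by rewrite !mulf_eq0 (negPf s0) (negPf kn0) /= => /eqP.
- split=> [/eqP|->]; last by rewrite mulr0.
  by rewrite !mulf_eq0 (negPf s0) (negPf kn0) /= => /eqP.
(* Each coefficient alone changes sign with [s]; in the product [s] appears squared, so the total
   factor is positive. *)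
have -> : s * k p ^+ 2 * a * (s * k p * b) =
    s ^+ 2 * k p ^+ 3 * (a * b) by ring.
rewrite sgrM gtr0_sg ?mul1r //.
by apply: mulr_gt0; [rewrite exprn_even_gt0|exact: exprn_gt0].
Qed.
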